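(* For every integer $h\geq 0$, as formal power series, $$F_h(x)=\sum_{n=0}^{\infty} f_h^n x^n=\frac{x^{h+1}}{p_{h+1}(x)\,p_h(x)}\qquad\text{and}\qquad F_{\leq h}(x)=\sum_{n=0}^{\infty} f_{\leq h}^n x^n=\frac{p_h(x)}{p_{h+1}(x)},$$ where $p_0(x)=1$, $p_1(x)=1-x$, and $p_{h+1}(x)=p_h(x)-x\,p_{h-1}(x)$ for $h\ge 1$.
   Context: All posets are finite. A semiorder is a poset with no induced subposet isomorphic to $\mathbf{2}+\mathbf{2}$ (disjoint union of two 2-element chains with no other comparabilities) or $\mathbf{3}+\mathbf{1}$ (disjoint union of a 3-element chain and a single incomparable element). Its length is the length of a longest chain (a chain with $\ell+1$ elements has length $\ell$). For $n\ge 0$, $f_h^n$ denotes the number of nonisomorphic unlabeled semiorders with $n$ elements and length $h$, and $f_{\leq h}^n$ the number of those with $n$ elements and length at most $h$. By convention $f_{\leq h}^0=1$ and $f_h^0=0$ for all $h\ge 0$ (the empty poset has length $-1$). *)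

(* Defs.v *)
From mathcomp Require Import all_boot all_order all_fingroup all_algebra.

Set Implicit Arguments.
Unset Strict Implicit.
Unset Printing Implicit Defensive.

Import Order.TTheory GRing.Theory Num.Theory.

Section Posets.

(* A poset is a finite type T with a non-strict order relation le. *)
Definition partial_order (T : finType) (le : rel T) : bool :=
  [&& [forall x, le x x],
      [forall x, forall y, le x y && le y x ==> (x == y)] &
      [forall x, forall y, forall z, le x y && le y z ==> le x z]].

Definition chain_rel (k : nat) : rel 'I_k := fun i j => (i <= j)%N.

(* Disjoint union of posets, without comparabilities between the two parts. *)
Definition sum_rel (S T : Type) (leS : rel S) (leT : rel T) : rel (S + T) :=
  fun u v => match u, v with
             | inl x, inl y => leS x y
             | inr x, inr y => leT x y
             | _, _ => false
             end.

Definition two_plus_two : rel ('I_2 + 'I_2)%type :=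
  sum_rel (@chain_rel 2) (@chain_rel 2).

Definition three_plus_one : rel ('I_3 + 'I_1)%type :=
  sum_rel (@chain_rel 3) (@chain_rel 1).

Definition has_induced (S T : finType) (leS : rel S) (leT : rel T) : bool :=
  [exists f : {ffun S -> T},
     injectiveb f && [forall x, forall y, leT (f x) (f y) == leS x y]].

Definition semiorder (T : finType) (le : rel T) : bool :=
  [&& partial_order le,
      ~~ has_induced two_plus_two le & ~~ has_induced three_plus_one le].

Definition is_chain (T : finType) (le : rel T) (C : {set T}) : bool :=
  [forall x in C, forall y in C, le x y || le y x].

(* An integer, so that the empty poset has length -1. *)
Definition poset_length (T : finType) (le : rel T) : int :=
  ((\max_(C : {set T} | is_chain le C) #|C|)%:Z - 1)%R.

End Posets.

Section Counting.

(* Relations are encoded by their graphs, so as to range over a finite type. *)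
Definition graph_rel (T : finType) (r : {set T * T}) : rel T :=
  fun x y => (x, y) \in r.

Definition poset_iso (T : finType) (r s : {set T * T}) : bool :=
  [exists f : {perm T},
     [forall x, forall y, graph_rel s (f x) (f y) == graph_rel r x y]].

Definition semiorders_eq (n h : nat) : {set {set 'I_n * 'I_n}} :=
  [set r | semiorder (graph_rel r) & poset_length (graph_rel r) == h%:Z%R].

Definition semiorders_le (n h : nat) : {set {set 'I_n * 'I_n}} :=
  [set r | semiorder (graph_rel r) & (poset_length (graph_rel r) <= h%:Z)%R].

Lemma poset_iso_equiv (T : finType) : equivalence_rel (@poset_iso T).
Proof.
have refl : reflexive (@poset_iso T).
  move=> r; apply/existsP; exists 1%g.
  by apply/forallP=> x; apply/forallP=> y; rewrite !perm1.
have sym r s : poset_iso r s -> poset_iso s r.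
  case/existsP=> f /forallP rs; apply/existsP; exists f^-1%g.
  apply/forallP=> x; apply/forallP=> y.
  by rewrite -(eqP (forallP (rs _) _)) !permKV.
have trans : transitive (@poset_iso T).
  move=> s r t /existsP[f /forallP rs] /existsP[g /forallP st].
  apply/existsP; exists (f * g)%g; apply/forallP=> x; apply/forallP=> y.
  by rewrite !permM (eqP (forallP (st _) _)) (eqP (forallP (rs _) _)).
move=> r s t; split=> [|rs]; first exact: refl.
by apply/idP/idP; apply: trans => //; exact: sym.
Qed.

(* The numbers of isomorphism classes of semiorders on n points of length h,
   resp. of length at most h. *)
Definition num_semiorders_eq (h n : nat) : nat :=
  #|equivalence_partition (@poset_iso 'I_n) (semiorders_eq n h)|.

Definition num_semiorders_le (h n : nat) : nat :=
  #|equivalence_partition (@poset_iso 'I_n) (semiorders_le n h)|.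

End Counting.

Local Open Scope ring_scope.

Section PowerSeries.

Variable R : fieldType.

(* A formal power series is its sequence of coefficients; two series are equal
   when they are extensionally equal (=1). *)
Definition fps : Type := nat -> R.

Definition fps_one : fps := fun n => (n == 0)%N%:R.

Definition fps_mul (a b : fps) : fps :=
  fun n => \sum_(i < n.+1) a i * b (n - i)%N.

Definition fps_of_poly (p : {poly R}) : fps := fun n => p`_n.

(* The first n coefficients c_0, ..., c_(n-1) of 1 / b when b_0 != 0, from
   b_0 c_m = [m = 0] - \sum_(i < m) c_i b_(m - i). *)
Fixpoint fps_inv_coefs (b : fps) (n : nat) : seq R :=
  if n is m.+1 then
    let c := fps_inv_coefs b m in
    rcons c ((b 0)^-1 * ((m == 0)%N%:R - \sum_(i < m) c`_i * b (m - i)%N))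
  else [::].

Definition fps_inv (b : fps) : fps := fun n => (fps_inv_coefs b n.+1)`_n.

Definition fps_div (a b : fps) : fps := fps_mul a (fps_inv b).

Lemma size_fps_inv_coefs b n : size (fps_inv_coefs b n) = n.
Proof. by elim: n => //= n IHn; rewrite size_rcons IHn. Qed.

Lemma nth_fps_inv_coefs b n i :
  (i < n)%N -> (fps_inv_coefs b n)`_i = fps_inv b i.
Proof.
elim: n => // n IHn; rewrite ltnS leq_eqVlt => /predU1P[-> //|lt_in].
by rewrite /= nth_rcons size_fps_inv_coefs lt_in IHn.
Qed.

Lemma fps_inv_rec b n :
  fps_inv b n =
  (b 0)^-1 * ((n == 0)%N%:R - \sum_(i < n) fps_inv b i * b (n - i)%N).
Proof.
rewrite {1}/fps_inv /= nth_rcons size_fps_inv_coefs ltnn eqxx.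
by under eq_bigr => i _ do rewrite nth_fps_inv_coefs //.
Qed.

Lemma fps_mulVf b : b 0 != 0 -> fps_mul (fps_inv b) b =1 fps_one.
Proof.
move=> b0 n; rewrite /fps_mul big_ord_recr /= subnn [fps_inv b n]fps_inv_rec.
by rewrite mulrAC mulVf // mul1r addrC subrK.
Qed.

End PowerSeries.

Fixpoint p (h : nat) : {poly rat} :=
  match h with
  | 0 => 1
  | h'.+1 => match h' with
             | 0 => 1 - 'X
             | h''.+1 => p h' - 'X * p h''
             end
  end.

Lemma p_rec h : p h.+2 = p h.+1 - 'X * p h.
Proof. by []. Qed.

(* Hence p h and p h.+1 * p h are invertible as power series. *)
Lemma coef0_p h : (p h)`_0 = 1.
Proof.
suff: (p h)`_0 = 1 /\ (p h.+1)`_0 = 1 by case.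
elim: h => [|h [IH0 IH1]]; first by rewrite /= coefB coef1 coefX subr0.
by rewrite p_rec coefB coefXM subr0 IH1.
Qed.

Definition F_eq (h : nat) : fps rat := fun n => (num_semiorders_eq h n)%:R.

Definition F_le (h : nat) : fps rat := fun n => (num_semiorders_le h n)%:R.

(* Main.v *)
(* Sorting the points of a semiorder by #(points below) - #(points above) makes
   every down-set {y | y < x} an initial segment, so a semiorder on n points is
   determined up to isomorphism by the nondecreasing sequence g(1), ..., g(n) of
   its down-set sizes, where g(i) < i.  A longest chain is found greedily from
   the top: starting with the last point, jump each time to the last point below
   it.  With g(0) = 0, the length is therefore at most h iff g^(h+1)(n) = 0.

   Write y_k = x p_(k-2) / p_(k-1), with p_(-1) = 1, so that
   y_(k+1) = x / (1 - y_k).  Reading g(n), g(n-1), ... from the top, the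
   sequences with g(n) = n - a - b and g^k(n - a) = 0 have generating function
   y_(k+1)^a y_k^b, because both sides satisfy
   E_k(a+1, b) = E_k(a+1, b+1) + x E_k(a, b) and E_(k+1)(0, b) = E_k(b, 0).
   Hence the sequences with g^k(n) = 0 are counted by 1 / (1 - y_k) =
   p_(k-1) / p_k, and F_h follows from the Cassini-type identity
   p_h^2 - p_(h+1) p_(h-1) = x^(h+1). *)

Require Import Defs.
From mathcomp Require Import all_boot all_order all_fingroup all_algebra.
From mathcomp Require Import zify ring.

Import GRing.Theory.
Local Open Scope ring_scope.

Set Implicit Arguments.
Unset Strict Implicit.
Unset Printing Implicit Defensive.

(** * Formal power series *)

(** Coefficient [n] of a product involves only finitely many coefficients of the factors, so
    commutativity and associativity descend from [{poly R}]. *)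
Lemma fps_mul_truncE (R : fieldType) (a b : fps R) N n : (n < N)%N ->
  fps_mul a b n = (\poly_(i < N) a i * \poly_(i < N) b i)`_n.
Proof.
move=> ltnN; rewrite coefM; apply: eq_bigr => i _.
by rewrite !coef_poly !ifT //; have := ltn_ord i; lia.
Qed.

Lemma fps_mulC (R : fieldType) (a b : fps R) : fps_mul a b =1 fps_mul b a.
Proof. by move=> n; rewrite !(fps_mul_truncE _ _ (ltnSn n)) mulrC. Qed.

Lemma eq_fps_mul (R : fieldType) (a a' b b' : fps R) :
  a =1 a' -> b =1 b' -> fps_mul a b =1 fps_mul a' b'.
Proof. by move=> eqa eqb n; apply: eq_bigr => i _; rewrite eqa eqb. Qed.

Lemma fps_mulA (R : fieldType) (a b c : fps R) :
  fps_mul a (fps_mul b c) =1 fps_mul (fps_mul a b) c.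
Proof.
have mulA3 (u v w : fps R) n : fps_mul (fps_mul u v) w n =
    (\poly_(i < n.+1) u i * \poly_(i < n.+1) v i * \poly_(i < n.+1) w i)`_n.
  rewrite coefM; apply: eq_bigr => i _.
  by rewrite (fps_mul_truncE _ _ (ltn_ord i)) coef_poly ifT //; lia.
by move=> n; rewrite fps_mulC !mulA3 mulrC mulrA.
Qed.

Lemma fps_mul1r (R : fieldType) (a : fps R) : fps_mul a (fps_one R) =1 a.
Proof.
move=> n; rewrite /fps_mul /fps_one big_ord_recr /= subnn mulr1 big1 ?add0r //.
by move=> i _; rewrite subn_eq0 leqNgt ltn_ord mulr0.
Qed.

Lemma fps_mulrBr (R : fieldType) (a b c : fps R) n :
  fps_mul a (fun m => b m - c m) n = fps_mul a b n - fps_mul a c n.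
Proof. by rewrite -sumrB; apply: eq_bigr => i _; rewrite mulrBr. Qed.

Lemma fps_mulrDr (R : fieldType) (a b c : fps R) n :
  fps_mul a (fun m => b m + c m) n = fps_mul a b n + fps_mul a c n.
Proof. by rewrite -big_split; apply: eq_bigr => i _; rewrite mulrDr. Qed.

Lemma fps_of_polyM (R : fieldType) (q r : {poly R}) :
  fps_of_poly (q * r) =1 fps_mul (fps_of_poly q) (fps_of_poly r).
Proof. by move=> n; rewrite /fps_of_poly coefM. Qed.

Lemma fps_mul_polyM (R : fieldType) (q r : {poly R}) (a : fps R) :
  fps_mul (fps_of_poly (q * r)) a =1
  fps_mul (fps_of_poly q) (fps_mul (fps_of_poly r) a).
Proof.
by move=> n; rewrite fps_mulA; apply: eq_fps_mul => // m; rewrite fps_of_polyM.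
Qed.

Lemma fps_mul_polyB (R : fieldType) (q r : {poly R}) (a : fps R) n :
  fps_mul (fps_of_poly (q - r)) a n =
  fps_mul (fps_of_poly q) a n - fps_mul (fps_of_poly r) a n.
Proof.
by rewrite -sumrB; apply: eq_bigr => i _; rewrite /fps_of_poly coefB mulrBl.
Qed.

Lemma fps_mul1l (R : fieldType) (a : fps R) : fps_mul (fps_of_poly 1) a =1 a.
Proof.
move=> n; rewrite fps_mulC -[RHS]fps_mul1r.
by apply: eq_fps_mul => // m; rewrite /fps_of_poly coef1.
Qed.

(** Quotients are identified by cross-multiplication, so that the identities below can be proved
    with denominators cleared. *)
Lemma fps_divE (R : fieldType) (a b c : fps R) :
  b 0%N != 0 -> fps_mul b c =1 a -> c =1 fps_div a b.
Proof.
move=> b0 bc n; rewrite /fps_div -(eq_fps_mul bc (frefl _)) fps_mulC fps_mulA.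
by rewrite (eq_fps_mul (fps_mulVf b0) (frefl _)) fps_mulC fps_mul1r.
Qed.

Definition shift (u : fps rat) : fps rat :=
  fun n => if n is m.+1 then u m else 0.

Lemma fps_mulXl (u : fps rat) : fps_mul (fps_of_poly 'X) u =1 shift u.
Proof.
case=> [|n]; first by rewrite /fps_mul big_ord1 /fps_of_poly coefX mul0r.
rewrite /fps_mul 2!big_ord_recl /fps_of_poly !coefX mul0r add0r mul1r subSS subn0.
by rewrite big1 ?addr0 // => i _; rewrite coefX mul0r.
Qed.

Lemma fps_mulX (q : {poly rat}) (u : fps rat) :
  fps_mul (fps_of_poly ('X * q)) u =1 fps_mul (fps_of_poly q) (shift u).
Proof.
move=> n; rewrite mulrC fps_mul_polyM.
exact: eq_fps_mul (fps_mulXl u) _.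
Qed.

Lemma fps_mul_shift (q : {poly rat}) (u : fps rat) :
  fps_mul (fps_of_poly q) (shift u) =1 shift (fps_mul (fps_of_poly q) u).
Proof.
by move=> n; rewrite -fps_mulX -fps_mulXl fps_mul_polyM.
Qed.

(** * Counting by bounces *)

(* The lists [:: g(n); ...; g(1)] in the notation of the header: reversed, so
   that a tail again lists a sequence of the same kind. *)
Fixpoint ballots (n : nat) : seq (seq nat) :=
  if n is m.+1 then
    [seq v :: s | s <- ballots m, v <- iota (head 0%N s) (m.+1 - head 0%N s)]
  else [:: [::]].

(** The entry [v] is g(i) for i = [size s' + 1], so [v <= size s'] encodes g(i) < i. *)
Fixpoint ballot (s : seq nat) : bool :=
  if s is v :: s' then [&& head 0%N s' <= v, v <= size s' & ballot s']%N
  else true.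

Lemma ballot_head s : ballot s -> (head 0 s <= (size s).-1)%N.
Proof. by case: s => //= v s /and3P[]. Qed.

Lemma mem_ballots n s : (s \in ballots n) = ballot s && (size s == n).
Proof.
elim: n s => [|n IHn] [|v s] //=; first by rewrite andbF.
  by apply/negP => /allpairsPdep[s [v []]].
apply/allpairsPdep/idP => [[s' [v' [s's v's [-> ->]]]]|].
  move: s's v's; rewrite IHn mem_iota => /andP[bs /eqP <-].
  have := ballot_head bs => le_h; rewrite /= bs eqxx !andbT subnKC //.
  exact: leq_trans le_h (leqW (leq_pred _)).
case/andP=> /and3P[ge_v le_v bs] /eqP[size_s].
exists s, v; split=> //; first by rewrite IHn bs size_s eqxx.
by rewrite mem_iota ge_v subnKC -size_s ?ltnS // (leq_trans ge_v) // leqW.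
Qed.

Lemma eq_count_ballots n (P Q : pred (seq nat)) :
  (forall s : seq nat, ballot s -> size s = n -> P s = Q s) ->
  count P (ballots n) = count Q (ballots n).
Proof.
move=> eqPQ; apply: eq_in_count => s.
by rewrite mem_ballots => /andP[bs /eqP /eqPQ->].
Qed.

Lemma uniq_ballots n : uniq (ballots n).
Proof.
elim: n => //= n IHn; apply: allpairs_uniq_dep => //.
  by move=> s _; apply: iota_uniq.
by move=> [? ?] [? ?] _ _ /= [-> ->].
Qed.

(* g^k(n) = 0; dropping all but the last g(n) entries replaces n by g(n). *)
Fixpoint bounces (k : nat) (s : seq nat) : bool :=
  if k is k'.+1 then bounces k' (drop (size s - head 0%N s) s) else s == [::].

Lemma bounces_nil k : bounces k [::].
Proof. by elim: k. Qed.

(** Dropping [a] entries moves the top from n to n - a, so the conditions are g(n) = n - a - b and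
    g^k(n - a) = 0. The additive form avoids truncated subtraction. *)
Definition bounce_count (k a b n : nat) : nat :=
  count (fun s => (head 0 s + a + b == n)%N && bounces k (drop a s)) (ballots n).

(* E_k(a, b) in the notation of the header. *)
Definition bounce_gf (k a b : nat) : fps rat :=
  fun n => (bounce_count k a b n)%:R.

Lemma bounce_gf_small k a b n : (n < a + b)%N -> bounce_gf k a b n = 0.
Proof.
move=> lt_n; rewrite /bounce_gf /bounce_count (eq_count (a2 := pred0)) ?count_pred0 // => s /=.
by case: eqP => //; lia.
Qed.

Lemma count_ballotsS (P : pred (seq nat)) n :
  count P (ballots n.+1) =
  (\sum_(s <- ballots n)
     count (fun v => P (v :: s)) (iota (head 0 s) (n.+1 - head 0 s)))%N.
Proof.
rewrite /= count_flatten -map_comp sumnE big_map.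
by apply: eq_bigr => s _; rewrite /= count_map.
Qed.

Lemma count_iota_eq (v m n : nat) : count (pred1 v) (iota m n) = (m <= v < m + n)%N.
Proof. by rewrite count_uniq_mem ?iota_uniq // mem_iota. Qed.

(** The top entry is forced to be n - a - b, and monotonicity then bounds the head of the tail by
    this value. *)
Lemma bounce_countS k a b n : (a + b <= n)%N ->
  bounce_count k a.+1 b n.+1 =
  count (fun s => (head 0 s + a + b <= n)%N && bounces k (drop a s)) (ballots n).
Proof.
move=> le_n; rewrite /bounce_count count_ballotsS -sum1_count [RHS]big_mkcond /=.
apply: eq_big_seq => s; rewrite mem_ballots => /andP[bs /eqP size_s].
rewrite (eq_count (a2 := fun v => (v == n - a - b)%N && bounces k (drop a s))).
  case: (bounces k _); last first.
    by rewrite andbF (eq_count (a2 := pred0)) ?count_pred0 // => v; rewrite /= andbF.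
  rewrite andbT (eq_count (a2 := pred1 (n - a - b)%N)) => [|v]; last by rewrite /= andbT.
  rewrite count_iota_eq.
  have := ballot_head bs; rewrite size_s => hs.
  by case: ifP; case: (boolP (_ && _)) => //; lia.
by move=> v /=; congr (_ && _); apply/eqP/eqP; lia.
Qed.

(** By [bounce_countS] the left side bounds the head of the tail; the two terms on the right are the
    cases of strict inequality and of equality. *)
Lemma bounce_gf_rec k a b n :
  bounce_gf k a.+1 b n = bounce_gf k a.+1 b.+1 n + shift (bounce_gf k a b) n.
Proof.
case: n => [|n]; first by rewrite /= !bounce_gf_small ?add0r //; lia.
have [le_n|lt_n] := leqP (a + b.+1) n; last first.
  rewrite (@bounce_gf_small k a.+1 b.+1) /=; last by lia.
  rewrite add0r; have [le_n|lt_n'] := leqP (a + b) n; last by rewrite !bounce_gf_small //; lia.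
  rewrite /bounce_gf bounce_countS // /bounce_count; congr _%:R; apply: eq_count => s /=.
  by congr (_ && _); lia.
rewrite /= /bounce_gf !bounce_countS; try lia.
rewrite -natrD; congr _%:R; rewrite /bounce_count.
rewrite -count_predUI [X in (_ + X)%N](eq_count (a2 := pred0)).
  rewrite count_pred0 addn0; apply: eq_count => s /=.
  by rewrite -andb_orl; congr (_ && _); lia.
by move=> s /=; case: (bounces _ _); rewrite ?andbF // !andbT; lia.
Qed.

(** The first bounce from n lands on g(n) = n - b, leaving k bounces from there. *)
Lemma bounce_gf_next k b : bounce_gf k.+1 0 b =1 bounce_gf k b 0.
Proof.
move=> n; congr _%:R; apply: eq_count_ballots => s _ size_s /=.
rewrite drop0 addn0 addn0; case: eqP => //= eq_n.
by rewrite size_s (_ : n - head 0 s = b)%N //; lia.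
Qed.

Lemma bounce_gf_00 k n : bounce_gf k 0 0 n = (n == 0%N)%:R.
Proof.
case: n => [|n]; first by rewrite /bounce_gf /bounce_count /= bounces_nil.
rewrite /bounce_gf /bounce_count (eq_count_ballots (Q := pred0)) ?count_pred0 //
  => s bs size_s /=.
by have := ballot_head bs; case: eqP => //; lia.
Qed.

(** With k = 0 the bounce condition forces n <= a, which excludes b > 0. Thus y_0 = 0 and y_1 =
    x. *)
Lemma bounce_gf_base a n : bounce_gf 0 a 0 n = (n == a)%:R.
Proof.
have E0pos a' b n' : bounce_gf 0 a' b.+1 n' = 0.
  rewrite /bounce_gf /bounce_count (eq_count_ballots (Q := pred0)) ?count_pred0 //
    => s _ size_s /=.
  case: eqP => //= eq_n; rewrite -size_eq0 size_drop size_s; lia.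
elim: a n => [|a IHa] n; first exact: bounce_gf_00.
by rewrite bounce_gf_rec E0pos add0r; case: n => //= n; rewrite IHa.
Qed.

(* [p] extended by p_(-1) = 1, with indices shifted by one. *)
Definition p_pred (k : nat) : {poly rat} := if k is k'.+1 then p k' else 1.

Lemma p_recS k : p k.+1 = p k - 'X * p_pred k.
Proof. by case: k => [|k]; rewrite ?p_rec //= mulr1. Qed.

Local Notation "q ** u" := (fps_mul (fps_of_poly q) u) (at level 40).

(** Transfers the factor y_(k+1) = x p_(k-1) / p_k from the first argument at level k to the second
    argument at level k + 1; [bounce_gf_next] starts the induction on [a]. *)
Lemma bounce_gf_ratio_step k :
  (forall b, p k ** bounce_gf k b.+1 0 =1 p_pred k ** shift (bounce_gf k b 0)) ->
  forall a b,
  p k ** bounce_gf k.+1 a b.+1 =1 p_pred k ** shift (bounce_gf k.+1 a b).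
Proof.
move=> IHk; elim=> [|a IHa] b n.
  rewrite (eq_fps_mul (frefl _) (bounce_gf_next k _)) IHk !fps_mul_shift.
  by case: n => //= n; apply: eq_fps_mul => // m; rewrite bounce_gf_next.
(* The recurrence leads from b to b + 1, so the induction is on n - b for a fixed coefficient n;
   once b >= n both sides vanish. *)
have [m] := ubnP (n - b); elim: m b => // m IHm b lt_m.
have [lt_n|le_n] := leqP n b.
  rewrite fps_mul_shift; case: n lt_n {IHm lt_m} => [|n1] lt_n; rewrite /shift /fps_mul.
    by rewrite big_ord1 bounce_gf_small ?mulr0.
  by rewrite !big1 // => i _; rewrite bounce_gf_small ?mulr0 //; have := ltn_ord i; lia.
have split_rec (c : {poly rat}) (u v w : fps rat) :
    u =1 (fun i => v i + w i) -> (c ** u) n = (c ** v) n + (c ** w) n.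
  by move=> eq_u; rewrite -fps_mulrDr; apply: eq_fps_mul.
rewrite (split_rec (p k) _ _ _ (bounce_gf_rec k.+1 a b.+1)).
rewrite (split_rec (p_pred k) _ (shift (bounce_gf k.+1 a.+1 b.+1))
  (shift (shift (bounce_gf k.+1 a b)))).
  rewrite IHm; last by lia.
  by congr (_ + _); rewrite !fps_mul_shift; case: (n) => //= n1; exact: IHa.
by case=> [|i] /=; rewrite ?addr0 // bounce_gf_rec.
Qed.

Lemma bounce_gf_ratio k b : p k ** bounce_gf k b.+1 0 =1 p_pred k ** shift (bounce_gf k b 0).
Proof.
elim: k b => [|k IHk] b n.
  rewrite /= !fps_mul1l bounce_gf_base; case: n => //= n; exact/esym/bounce_gf_base.
(* Since x p_(k-1) E_(k+1)(b+1, 0) = p_k E_(k+1)(b+1, 1), the difference is p_k x E_(k+1)(b, 0).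
   This is the relation y_(k+2) = x / (1 - y_(k+1)). *)
rewrite p_recS fps_mul_polyB fps_mulX -bounce_gf_ratio_step // -fps_mulrBr.
by apply: eq_fps_mul => // i; rewrite bounce_gf_rec addrC addKr.
Qed.

(** Prepending the largest admissible entry n to a list of length n shows that x times this series
    is E_k(1, 0), which equals y_(k+1) because E_k(0, 0) = 1. *)
Lemma p_bounces_count k :
  p k ** (fun n => (count (bounces k) (ballots n))%:R) =1 fps_of_poly (p_pred k).
Proof.
move=> n; have /= := bounce_gf_ratio k 0 n.+1; rewrite fps_mul_shift /=.
have -> : fps_mul (fps_of_poly (p_pred k)) (bounce_gf k 0 0) n = fps_of_poly (p_pred k) n.
  by rewrite (eq_fps_mul (frefl _) (bounce_gf_00 k)) fps_mul1r.
move<-; rewrite /fps_mul [RHS]big_ord_recr /= subnn bounce_gf_small // mulr0 addr0.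
apply: eq_bigr => i _; rewrite subSn; last by have := ltn_ord i; lia.
congr (_ * _); rewrite /bounce_gf bounce_countS ?add0n //; congr _%:R.
apply: eq_count_ballots => s bs size_s.
by have := ballot_head bs; rewrite drop0; case: (bounces _ _); rewrite ?andbF // andbT; lia.
Qed.

Lemma p_cassini h : p h * p h - p h.+1 * p_pred h = 'X^(h.+1).
Proof.
elim: h => [|h IHh]; first by rewrite /=; ring.
have -> : p_pred h.+1 = p h by [].
rewrite exprS -IHh p_rec; move: (p_recS h).
by move: (p h) (p h.+1) (p_pred h) => p0 p1 p_ ->; ring.
Qed.

Lemma bounces_le_gf h :
  (fun n => (count (bounces h.+1) (ballots n))%:R) =1
  fps_div (fps_of_poly (p h)) (fps_of_poly (p h.+1)).
Proof.
by apply: fps_divE; [rewrite /fps_of_poly coef0_p | exact: p_bounces_count].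
Qed.

Lemma bounces_eq_gf h :
  (fun n => (count (bounces h.+1) (ballots n))%:R - (count (bounces h) (ballots n))%:R) =1
  fps_div (fps_of_poly 'X^(h.+1)) (fps_of_poly (p h.+1 * p h)).
Proof.
apply: fps_divE => [|n]; first by rewrite /fps_of_poly coef0M !coef0_p mulr1.
(* The product is commuted in one term only, so that each series first meets the polynomial clearing
   its denominator. *)
rewrite fps_mulrBr {1}[p h.+1 * p h]mulrC !fps_mul_polyM.
rewrite !(eq_fps_mul (frefl _) (p_bounces_count _)) -!fps_of_polyM.
by rewrite /fps_of_poly -coefB p_cassini.
Qed.

(** * Semiorders *)

(** Classes are the fibres of the complete invariant [inv], whose values [L] lists without
    repetition. *)
Lemma card_equivalence_partition_seq (T : finType) (K : choiceType) (R : rel T)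
    (D : {set T}) (inv : T -> K) (L : seq K) :
  uniq L -> {in D, forall r, inv r \in L} ->
  {in L, forall l, exists2 r, r \in D & inv r = l} ->
  {in D &, forall r s, R r s = (inv r == inv s)} ->
  #|equivalence_partition R D| = size L.
Proof.
move=> uniqL invL invD invR; rewrite -(card_seq_sub uniqL).
pose F (l : seq_sub L) := [set r in D | inv r == val l].
have inD x : x \in D -> [set y in D | R x y] = [set y in D | inv y == inv x].
  by move=> Dx; apply/setP=> y; rewrite !inE;
    case: (boolP (y \in D)) => //= Dy; rewrite invR // eq_sym.
have -> : equivalence_partition R D = F @: [set: seq_sub L].
  apply/setP=> B; apply/imsetP/imsetP=> [[x Dx ->]|[l _ ->]].
    exists (SeqSub (invL x Dx)) => //; exact: inD.
  by have [r Dr inv_r] := invD _ (valP l); exists r => //; rewrite inD // inv_r.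
rewrite card_imset ?cardsT // => l1 l2 eqF; apply: val_inj.
have [r Dr inv_r] := invD _ (valP l1).
have: r \in F l1 by rewrite inE Dr inv_r eqxx.
by rewrite eqF inE Dr inv_r /= => /eqP.
Qed.

(** * Forbidden subposets as axioms on the strict order *)

Definition slt (T : finType) (le : rel T) : rel T :=
  fun x y => le x y && (x != y).

Section SemiorderAxioms.

Variables (T : finType) (le : rel T).
Local Notation lt := (slt le).

(** Here and in [unit_like], exclusion of 2+2 and of 3+1 takes a positive form, for points not
    assumed distinct or incomparable. *)
Definition interval_like :=
  forall a b c d, lt a b -> lt c d -> lt a d || lt c b.
Definition unit_like :=
  forall a b c x, lt a b -> lt b c -> lt a x || lt x c.

Lemma partial_orderP :
  reflect [/\ reflexive le, antisymmetric le & transitive le] (partial_order le).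
Proof.
apply: (iffP and3P) => [[/forallP r /forallP a /forallP t]|[r a t]]; split.
- exact: r.
- by move=> x y le_xy; apply/eqP; have /forallP/(_ y)/implyP := a x; apply.
- move=> y x z le_xy le_yz; have /forallP/(_ y)/forallP/(_ z)/implyP := t x.
  by apply; rewrite le_xy.
- exact/forallP.
- by apply/forallP=> x; apply/forallP=> y; apply/implyP=> /a ->.
- apply/forallP=> x; apply/forallP=> y; apply/forallP=> z; apply/implyP=> /andP[].
  exact: t.
Qed.

Lemma slt_trans : partial_order le -> transitive lt.
Proof.
case/partial_orderP=> _ a t y x z /andP[le_xy ne_xy] /andP[le_yz ne_yz].
apply/andP; split; first exact: t le_yz.
by apply: contra ne_xy => /eqP eq_xz; rewrite (a x y) // le_xy eq_xz.
Qed.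

Lemma slt_irr x : lt x x = false.
Proof. by rewrite /slt eqxx andbF. Qed.

Lemma le_slt : reflexive le -> forall x y, le x y = (x == y) || lt x y.
Proof. by move=> r x y; rewrite /slt; case: eqP => [->|_]; rewrite ?r ?andbT. Qed.

Lemma slt_le :
  partial_order le -> forall x y, lt x y -> le x y = true /\ le y x = false.
Proof.
move=> po x y xy; have [r _ _] := partial_orderP po; have [le_xy ne_xy] := andP xy.
split=> //; rewrite le_slt // eq_sym (negbTE ne_xy); apply/negP=> yx.
by have := slt_trans po xy yx; rewrite slt_irr.
Qed.

Lemma incomparable_le : reflexive le ->
  forall x y, lt x y = false -> lt y x = false -> (x == y) = false ->
  le x y = false /\ le y x = false.
Proof. by move=> r x y xy yx e_xy; rewrite !le_slt // [y == x]eq_sym xy yx e_xy. Qed.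

(** Injectivity comes for free: equal images force both comparabilities in [leS]. *)
Lemma has_induced_eq (S : finType) (leS : rel S) :
  antisymmetric leS -> reflexive leS ->
  reflect (exists f : S -> T, forall u v, le (f u) (f v) = leS u v)
    (has_induced leS le).
Proof.
move=> aS rS; apply: (iffP existsP) => [[f /andP[_ /forallP fP]]|[f fP]].
  by exists f => u v; apply/eqP; apply: (forallP (fP u)).
exists [ffun u => f u]; apply/andP; split.
  apply/injectiveP=> u v; rewrite !ffunE => eqf; apply: aS.
  by rewrite -!fP eqf fP rS.
by apply/forallP=> u; apply/forallP=> v; rewrite !ffunE fP.
Qed.

Lemma chain_rel_anti k : antisymmetric (@chain_rel k).
Proof. by move=> i j /anti_leq/val_inj. Qed.

Lemma sum_rel_anti (A B : Type) (leA : rel A) (leB : rel B) :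
  antisymmetric leA -> antisymmetric leB -> antisymmetric (sum_rel leA leB).
Proof. by move=> aA aB [x|x] [y|y] //= => [/aA|/aB] ->. Qed.

Lemma sum_rel_refl (A B : Type) (leA : rel A) (leB : rel B) :
  reflexive leA -> reflexive leB -> reflexive (sum_rel leA leB).
Proof. by move=> rA rB [x|x] /=. Qed.

Lemma chain_rel_refl k : reflexive (@chain_rel k).
Proof. by move=> i; apply: leqnn. Qed.

(** Any other comparability or coincidence between the two chains would yield [lt a d] or [lt c b]
    by transitivity. *)
Lemma two_plus_twoP : partial_order le ->
  reflect (exists a b c d, [/\ lt a b, lt c d, ~~ lt a d & ~~ lt c b])
    (has_induced two_plus_two le).
Proof.
move=> po; have tr := slt_trans po; have [r a _] := partial_orderP po.
have lt_le := slt_le po; have inc_le := incomparable_le r.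
apply: (iffP (has_induced_eq _ _)).
- by apply: sum_rel_anti; apply: chain_rel_anti.
- by apply: sum_rel_refl; apply: chain_rel_refl.
- case=> f fP.
  exists (f (inl ord0)), (f (inl ord_max)), (f (inr ord0)), (f (inr ord_max)).
  rewrite /slt !fP /=.
  have neq u v : ~~ two_plus_two u v -> f u != f v.
    by apply: contra => /eqP eqf; rewrite -fP eqf r.
  by rewrite ![f _ == f (_ ord_max)]eq_sym !neq.
case=> x [y [z [t [xy zt n_xt n_zy]]]].
exists (fun u => match u with
  | inl i => if i == ord0 then x else y
  | inr i => if i == ord0 then z else t end).
have n_xz : lt x z = false by apply: contraNF n_xt => xz; exact: (tr _ _ _ xz zt).
have n_zx : lt z x = false by apply: contraNF n_zy => zx; exact: (tr _ _ _ zx xy).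
have n_tx : lt t x = false.
  by apply: contraNF n_zy => tx; exact: (tr _ _ _ zt (tr _ _ _ tx xy)).
have n_yz : lt y z = false.
  by apply: contraNF n_xt => yz; exact: (tr _ _ _ (tr _ _ _ xy yz) zt).
have n_yt : lt y t = false by apply: contraNF n_xt => yt; exact: (tr _ _ _ xy yt).
have n_ty : lt t y = false by apply: contraNF n_zy => ty; exact: (tr _ _ _ zt ty).
have e_xz : (x == z) = false by apply: contraNF n_xt => /eqP->.
have e_xt : (x == t) = false.
  by apply: contraNF n_zy => /eqP e; rewrite e in xy; exact: (tr _ _ _ zt xy).
have e_yz : (y == z) = false.
  by apply: contraNF n_xt => /eqP e; move: xy; rewrite e => xz;
    exact: (tr _ _ _ xz zt).
have e_yt : (y == t) = false by apply: contraNF n_xt => /eqP <-.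
have [le_xy le_yx] := lt_le _ _ xy; have [le_zt le_tz] := lt_le _ _ zt.
have [le_xz le_zx] := inc_le _ _ n_xz n_zx e_xz.
have [le_xt le_tx] := inc_le _ _ (negbTE n_xt) n_tx e_xt.
have [le_yz le_zy] := inc_le _ _ n_yz (negbTE n_zy) e_yz.
have [le_yt le_ty] := inc_le _ _ n_yt n_ty e_yt.
by move=> [[[|[|//]] i]|[[|[|//]] i]] [[[|[|//]] j]|[[|[|//]] j]] /=;
  rewrite ?r ?(le_xy, le_yx, le_zt, le_tz, le_xz, le_zx,
    le_xt, le_tx, le_yz, le_zy, le_yt, le_ty).
Qed.

(** If [x] were below or equal to a chain point other than [c], it would be below [c]; if above or
    equal to one other than [a], it would be above [a]. *)
Lemma three_plus_oneP : partial_order le ->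
  reflect (exists a b c x, [/\ lt a b, lt b c, ~~ lt a x & ~~ lt x c])
    (has_induced three_plus_one le).
Proof.
move=> po; have tr := slt_trans po; have [r a _] := partial_orderP po.
have lt_le := slt_le po; have inc_le := incomparable_le r.
apply: (iffP (has_induced_eq _ _)).
- by apply: sum_rel_anti; apply: chain_rel_anti.
- by apply: sum_rel_refl; apply: chain_rel_refl.
- case=> f fP.
  exists (f (inl ord0)), (f (inl (inord 1))), (f (inl ord_max)), (f (inr ord0)).
  have neq u v : ~~ three_plus_one v u -> f u != f v.
    by apply: contra => /eqP eqf; rewrite -fP eqf r.
  by rewrite /slt !fP /= !neq //= /chain_rel /= inordK.
case=> x [y [z [t [xy yz n_xt n_tz]]]].
exists (fun u => match u with
  | inl i => if i == ord0 then x else if i == ord_max then z else y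
  | inr i => t end).
have xz : lt x z := tr _ _ _ xy yz.
have n_tx : lt t x = false by apply: contraNF n_tz => tx; exact: (tr _ _ _ tx xz).
have n_ty : lt t y = false by apply: contraNF n_tz => ty; exact: (tr _ _ _ ty yz).
have n_yt : lt y t = false by apply: contraNF n_xt => yt; exact: (tr _ _ _ xy yt).
have n_zt : lt z t = false by apply: contraNF n_xt => zt; exact: (tr _ _ _ xz zt).
have e_xt : (x == t) = false by apply: contraNF n_tz => /eqP <-.
have e_yt : (y == t) = false by apply: contraNF n_xt => /eqP <-.
have e_zt : (z == t) = false by apply: contraNF n_xt => /eqP <-.
have [le_xy le_yx] := lt_le _ _ xy; have [le_yz le_zy] := lt_le _ _ yz.
have [le_xz le_zx] := lt_le _ _ xz.
have [le_xt le_tx] := inc_le _ _ (negbTE n_xt) n_tx e_xt.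
have [le_yt le_ty] := inc_le _ _ n_yt n_ty e_yt.
have [le_zt le_tz] := inc_le _ _ n_zt (negbTE n_tz) e_zt.
by move=> [[[|[|[|//]]] i]|[[|//] i]] [[[|[|[|//]]] j]|[[|//] j]] /=;
  rewrite ?r ?(le_xy, le_yx, le_zt, le_tz, le_xz, le_zx,
    le_xt, le_tx, le_yz, le_zy, le_yt, le_ty).
Qed.

Lemma semiorderP :
  reflect [/\ partial_order le, interval_like & unit_like] (semiorder le).
Proof.
apply: (iffP and3P) => [[po n22 n31]|[po int unit]]; split=> //.
- move=> x y z t xy zt; apply: contraNT n22; rewrite negb_or => /andP[? ?].
  by apply/two_plus_twoP => //; exists x, y, z, t.
- move=> x y z t xy yz; apply: contraNT n31; rewrite negb_or => /andP[? ?].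
  by apply/three_plus_oneP => //; exists x, y, z, t.
- apply/negP => /(two_plus_twoP po)[x [y [z [t [xy zt /negbTE n1 /negbTE n2]]]]].
  by have := int _ _ _ _ xy zt; rewrite n1 n2.
apply/negP => /(three_plus_oneP po)[x [y [z [t [xy yz /negbTE n1 /negbTE n2]]]]].
by have := unit _ _ _ t xy yz; rewrite n1 n2.
Qed.

End SemiorderAxioms.

(** * Down-set sizes as an isomorphism invariant *)

Lemma geqn_total : total geq. Proof. by move=> m n; apply: leq_total. Qed.

Lemma geqn_trans : transitive geq.
Proof. by move=> m n q nm qn; apply: leq_trans qn nm. Qed.

Lemma geqn_anti : antisymmetric geq.
Proof. by move=> m n /andP[mn nm]; apply/anti_leq/andP. Qed.

Section Profile.

Variables (T : finType) (le : rel T).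

Definition below x : {set T} := [set y | slt le y x].
Definition above x : {set T} := [set y | slt le x y].

(** The decreasing order matches [ballots], whose lists begin with g(n). *)
Definition profile : seq nat := sort geq [seq #|below x| | x : T].

Lemma size_profile : size profile = #|T|.
Proof. by rewrite size_sort size_map -cardT. Qed.

End Profile.

Lemma perm_enum_map (T : finType) (f : {perm T}) :
  perm_eq (map f (enum T)) (enum T).
Proof.
apply: uniq_perm; rewrite ?enum_uniq ?(map_inj_uniq perm_inj) ?enum_uniq // => x.
by rewrite mem_enum -(permKV f x) mem_map ?mem_enum //; apply: perm_inj.
Qed.

Section Iso.

Variables (T : finType) (le le' : rel T) (f : {perm T}).
Hypothesis le_f : forall x y, le' (f x) (f y) = le x y.

Lemma slt_iso x y : slt le' (f x) (f y) = slt le x y.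
Proof. by rewrite /slt le_f (inj_eq perm_inj). Qed.

Lemma below_iso x : below le' (f x) = f @: below le x.
Proof.
apply/setP=> y; rewrite -(permKV f y) mem_imset; last exact: perm_inj.
by rewrite !inE slt_iso.
Qed.

Lemma profile_iso : profile le' = profile le.
Proof.
apply/(perm_sortP geqn_total geqn_trans geqn_anti); rewrite perm_sym.
have /(perm_map (fun x => #|below le' x|)) := perm_enum_map f.
rewrite -map_comp; congr perm_eq; rewrite /image_mem; apply: eq_map => x /=.
by rewrite below_iso card_imset //; apply: perm_inj.
Qed.

Lemma is_chain_iso (C : {set T}) : is_chain le' (f @: C) = is_chain le C.
Proof.
apply/forall_inP/forall_inP => chC x.
  move=> Cx; have /forall_inP chx := chC _ (imset_f f Cx).
  by apply/forall_inP=> y Cy; have := chx _ (imset_f f Cy); rewrite !le_f.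
case/imsetP=> {}x Cx ->; apply/forall_inP=> y /imsetP[{}y Cy ->].
by rewrite !le_f; have /forall_inP := chC _ Cx; apply.
Qed.

Lemma poset_length_iso : poset_length le' = poset_length le.
Proof.
rewrite /poset_length (reindex_inj (imset_inj (@perm_inj _ f))) /=.
congr (_%:Z - 1); apply: eq_big => C; first exact: is_chain_iso.
by move=> _; rewrite card_imset //; apply: perm_inj.
Qed.

End Iso.

(* g(i + 1) in the notation of the header, for points numbered from 0; it is 0
   past the end of [s]. *)
Definition down_size (s : seq nat) (i : nat) : nat := nth 0%N (rev s) i.

(** Inverse construction to [profile]: strict down-sets are initial segments of prescribed sizes. *)
Definition canon_nat (s : seq nat) : rel nat :=
  fun j i => (j == i) || (j < down_size s i)%N.

Definition canon_graph (n : nat) (s : seq nat) : {set 'I_n * 'I_n} :=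
  [set u : 'I_n * 'I_n | canon_nat s u.1 u.2].

(** [n] may exceed [size s]: the chain arguments shorten the list and keep the carrier. *)
Definition canon_rel (n : nat) (s : seq nat) : rel 'I_n :=
  graph_rel (canon_graph n s).

Lemma canon_relE n s (i j : 'I_n) : canon_rel s i j = canon_nat s i j.
Proof. by rewrite /canon_rel /graph_rel inE. Qed.

Lemma down_size_cons v s i :
  down_size (v :: s) i =
  if (i < size s)%N then down_size s i
  else if (i == size s)%N then v else 0%N.
Proof. by rewrite /down_size rev_cons nth_rcons size_rev. Qed.

Lemma down_size_default s i : (size s <= i)%N -> down_size s i = 0%N.
Proof. by move=> le_i; rewrite /down_size nth_default ?size_rev. Qed.

Lemma down_size_last s : down_size s (size s).-1 = head 0%N s.
Proof. by case: s => [|v s] //=; rewrite down_size_cons ltnn eqxx. Qed.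

Lemma down_size_le s i : ballot s -> (down_size s i <= i)%N.
Proof.
elim: s => [|v s IHs] /=; first by rewrite down_size_default.
case/and3P=> _ le_v bs; rewrite down_size_cons; case: ltnP => // _; first exact: IHs.
by case: eqP => [->|].
Qed.

Lemma down_size_mono s i j :
  ballot s -> (i <= j < size s)%N -> (down_size s i <= down_size s j)%N.
Proof.
elim: s j => [|v s IHs] j /=; first by rewrite ltn0 andbF.
case/and3P=> le_h le_v bs /andP[le_ij]; rewrite ltnS !down_size_cons leq_eqVlt.
case/predU1P=> [ej|lt_j]; last by rewrite lt_j (leq_ltn_trans le_ij) // IHs // le_ij.
rewrite {}ej in le_ij *; rewrite ltnn eqxx; case: ltngtP le_ij => // lt_i _.
by apply: leq_trans le_h; rewrite -down_size_last; apply: IHs => //; lia.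
Qed.

Lemma ballot_of_down_size s :
  sorted geq s -> (forall i, i < size s -> down_size s i <= i)%N -> ballot s.
Proof.
elim: s => //= v s IHs sorted_s le_lev.
have le_v : (v <= size s)%N.
  by have := le_lev _ (ltnSn _); rewrite down_size_cons ltnn eqxx.
rewrite le_v IHs ?(path_sorted sorted_s) //.
  by case: s sorted_s {IHs le_lev le_v} => //= w s /andP[->].
by move=> i lt_i; have := le_lev i (ltnW lt_i); rewrite down_size_cons lt_i.
Qed.

Lemma ballot_sorted s : ballot s -> sorted geq s.
Proof.
elim: s => //= v s IHs /and3P[le_h _ /IHs].
by case: s le_h {IHs} => //= w s -> ->.
Qed.

Lemma ballot_drop d s : ballot s -> ballot (drop d s).
Proof.
by elim: d s => [|d IHd] s; rewrite ?drop0 //; case: s => //= v s /and3P[_ _ /IHd].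
Qed.

Lemma down_size_drop d s i :
  (i < size s - d)%N -> down_size (drop d s) i = down_size s i.
Proof. by move=> lt_i; rewrite /down_size rev_drop nth_take. Qed.

Lemma slt_canon_rel n s (j i : 'I_n) :
  ballot s -> slt (canon_rel s) j i = (j < down_size s i)%N.
Proof.
move=> bs; rewrite /slt canon_relE /canon_nat -val_eqE /=; case: eqP => [->|_] /=.
  by apply/esym/negbTE; rewrite -leqNgt down_size_le.
by rewrite andbT.
Qed.

(** Initial segments are nested, which excludes 2+2. For 3+1, if [x] is not below [c] then b < g(c)
    <= x, so by monotonicity the down-set of [x] contains that of [b], hence [a]. *)
Lemma semiorder_canon_rel n s :
  ballot s -> size s = n -> semiorder (@canon_rel n s).
Proof.
move=> bs size_s; apply/semiorderP; split.
- apply/partial_orderP; split=> [i|i j|j i k]; rewrite !canon_relE /canon_nat ?eqxx //.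
    have := down_size_le i bs; have := down_size_le j bs => ? ? ?.
    by apply: val_inj => /=; lia.
  case/predU1P=> [->//|ij]; case/predU1P=> [<-|jk]; first by rewrite ij orbT.
  by have := down_size_le j bs; lia.
- move=> a b c d; rewrite !slt_canon_rel //; lia.
move=> a b c x; rewrite !slt_canon_rel // => ab bc.
have [//|le_xa] := ltnP; have [//|le_cx] := ltnP.
have := @down_size_mono s b x bs; have := ltn_ord x; have := down_size_le x bs; lia.
Qed.

Lemma card_ord_lt n m : (m <= n)%N -> #|[set j : 'I_n | (j < m)%N]| = m.
Proof.
by move=> le_mn; rewrite cardsE -sum1_card -(big_ord_widen n (fun=> 1%N)) ?sum1_card ?card_ord.
Qed.

Lemma profile_canon_rel n s :
  ballot s -> size s = n -> profile (@canon_rel n s) = s.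
Proof.
move=> bs size_s.
apply: (sorted_eq geqn_trans geqn_anti).
- exact: sort_sorted geqn_total _.
- exact: ballot_sorted.
rewrite perm_sort perm_sym -(perm_rev s) perm_sym.
suff -> : [seq #|below (@canon_rel n s) x| | x : 'I_n] = rev s by [].
rewrite -[RHS](mkseq_nth 0%N) size_rev size_s /mkseq -val_enum_ord -map_comp.
apply: eq_map => x /=; rewrite -[RHS](@card_ord_lt n).
  by apply: eq_card => y; rewrite !inE slt_canon_rel.
exact: leq_trans (down_size_le x bs) (ltnW (ltn_ord x)).
Qed.

(** If [j] is in [A], so are 0, ..., j, and [A] has more than j elements; otherwise [A] lies
    strictly below [j]. *)
Lemma downclosedE n (A : {set 'I_n}) :
  (forall i j : 'I_n, (i <= j)%N -> j \in A -> i \in A) ->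
  forall j, (j \in A) = (j < #|A|)%N.
Proof.
move=> downA j; apply/idP/idP => [Aj|]; last apply: contraTT => nAj.
  rewrite -[X in (X <= _)%N](@card_ord_lt n j.+1) // subset_leq_card //.
  by apply/subsetP=> i; rewrite inE ltnS => /downA; apply.
rewrite -leqNgt; apply: (@leq_trans #|[set i : 'I_n | (i < j)%N]|); last first.
  by rewrite card_ord_lt // ltnW.
rewrite subset_leq_card //; apply/subsetP=> i Ai; rewrite inE ltnNge.
by apply: contra nAj => /downA; exact.
Qed.

(** * Canonical form of a semiorder *)

Section CanonicalForm.

Variables (n : nat) (le : rel 'I_n).
Hypothesis semi : semiorder le.
Local Notation lt := (slt le).

(** Number of points below minus number above, shifted by [n] to stay a natural number. *)
Definition score (x : 'I_n) : nat := (#|below le x| + (n - #|above le x|))%N.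

(* If [y] failed one of the two inclusions, 2+2-freeness would make it strict,
   and then the score inequality would force the other one to fail strictly as
   well, giving a 3+1. *)
Lemma score_mono z y : (score z <= score y)%N ->
  below le z \subset below le y /\ above le y \subset above le z.
Proof.
have [_ int unit] := semiorderP _ semi.
have le_above x : (#|above le x| <= n)%N by rewrite -[X in (_ <= X)%N]card_ord max_card.
have := le_above z; have := le_above y; rewrite /score => le_y le_z le_score.
split; apply/subsetP=> a; rewrite !inE => lt_a; apply: contraT => nlt_a.
- have: (#|below le y| < #|below le z|)%N.
    apply: proper_card; apply/properP; split; last by exists a; rewrite inE.
    apply/subsetP=> c; rewrite !inE => cy.
    by have := int _ _ _ _ lt_a cy; rewrite (negbTE nlt_a).
  move=> lt_b; have /subsetPn[b]: ~~ (above le z \subset above le y).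
    by apply/negP => /subset_leq_card; lia.
  rewrite !inE => zb nyb.
  by have := unit _ _ _ y lt_a zb; rewrite (negbTE nyb) (negbTE nlt_a).
have: (#|above le z| < #|above le y|)%N.
  apply: proper_card; apply/properP; split; last by exists a; rewrite inE.
  apply/subsetP=> c; rewrite !inE => zc.
  by have := int _ _ _ _ zc lt_a; rewrite (negbTE nlt_a).
move=> lt_b; have /subsetPn[b]: ~~ (below le y \subset below le z).
  by apply/negP => /subset_leq_card; lia.
rewrite !inE => byy nbz.
by have := unit _ _ _ z byy lt_a; rewrite (negbTE nbz) (negbTE nlt_a).
Qed.

Lemma score_sorting : exists f : {perm 'I_n},
  forall i j : 'I_n, (i <= j)%N -> (score (f i) <= score (f j))%N.
Proof.
pose e := sort (relpre score leq) (enum 'I_n).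
have size_e : size e = n by rewrite size_sort size_enum_ord.
have uniq_e : uniq e by rewrite sort_uniq enum_uniq.
(* The default [i] is never reached; it only supplies an element of ['I_n]. *)
have inj_e : injective (fun i : 'I_n => nth i e i).
  move=> i j; rewrite (set_nth_default i j) ?size_e // => /eqP.
  by rewrite nth_uniq ?size_e // => /eqP/val_inj.
exists (perm inj_e) => i j le_ij; rewrite !permE (set_nth_default i j) ?size_e //.
have sorted_e : sorted (relpre score leq) e by apply: sort_sorted => x y; apply: leq_total.
apply: (sorted_leq_nth _ _ i sorted_e) => //; rewrite ?inE ?size_e //.
by move=> x y z /=; apply: leq_trans.
by move=> x /=.
Qed.

Lemma canonical_form : exists f : {perm 'I_n},
  [/\ forall i j, le (f i) (f j) = canon_rel (profile le) i j & ballot (profile le)].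
Proof.
have [f score_f] := score_sorting.
have [po _ _] := semiorderP _ semi; have [r _ _] := partial_orderP _ po.
pose le' : rel 'I_n := fun i j => le (f i) (f j).
have le'_f x y : le (f x) (f y) = le' x y by [].
(* A point of smaller score has a larger up-set, so down-sets are closed under decreasing the
   index. *)
have below'E i j : slt le' j i = (j < #|below le' i|)%N.
  rewrite -(downclosedE (A := below le' i)) ?inE // => j1 j2 le_j; rewrite !inE.
  rewrite -!(slt_iso le'_f).
  have [_ /subsetP/(_ (f i))] := score_mono (score_f _ _ le_j).
  by rewrite !inE.
have mono_below (i j : 'I_n) : (i <= j)%N -> (#|below le' i| <= #|below le' j|)%N.
  move=> le_ij; have [/subset_leq_card] := score_mono (score_f _ _ le_ij).
  by rewrite !(below_iso le'_f) !card_imset //; apply: perm_inj.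
have rev_profile : rev (profile le) = [seq #|below le' i| | i : 'I_n].
  have leq_anti : antisymmetric leq by move=> m k /anti_leq.
  apply: (sorted_eq leq_trans leq_anti).
  - by rewrite rev_sorted; apply: sort_sorted => m k; apply: leq_total.
  - rewrite sorted_map; apply: (@sub_sorted _ (relpre val leq)) => [i j /mono_below //|].
    by rewrite -sorted_map val_enum_ord iota_sorted.
  by rewrite perm_rev (profile_iso le'_f) perm_sort.
have down_sizeE (i : 'I_n) : down_size (profile le) i = #|below le' i|.
  rewrite /down_size rev_profile (nth_map i) ?nth_ord_enum //.
  by rewrite size_enum_ord.
exists f; split=> [i j|].
  rewrite le'_f le_slt => [|x]; last by rewrite /le' r.
  by rewrite below'E ?canon_relE /canon_nat down_sizeE.
apply: ballot_of_down_size => [|i]; first exact: sort_sorted geqn_total _.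
rewrite size_profile card_ord => lt_i.
(* The bound on the down-set size is irreflexivity: a point is not in its own initial segment. *)
rewrite (down_sizeE (Ordinal lt_i)) leqNgt.
by have := below'E (Ordinal lt_i) (Ordinal lt_i); rewrite slt_irr /= => <-.
Qed.

End CanonicalForm.

(** * Longest chains and bounces *)

Lemma card_chain_le k s n (C : {set 'I_n}) : ballot s -> bounces k s ->
  {in C, forall x : 'I_n, (x < size s)%N} -> is_chain (canon_rel s) C -> (#|C| <= k)%N.
Proof.
elim: k s C => [|k IHk] s C bs /=.
  move=> /eqP -> lt_C _; rewrite leqn0 cards_eq0; apply/set0Pn => -[x /lt_C].
  by rewrite ltn0.
move=> bnc_s lt_C /forall_inP chC.
have [->|[x0 Cx0]] := set_0Vmem C; first by rewrite cards0.
(* Removing the largest-numbered point leaves a chain among the first [head 0 s] points, exactly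
   those kept by one bounce. *)
case: (@arg_maxnP _ x0 [in C] (fun i => val i) Cx0) => x Cx max_x.
rewrite (cardsD1 x) Cx add1n ltnS.
have below_x y : y \in C :\ x -> (y < head 0 s)%N.
  case/setD1P=> ne_yx Cy; have /forall_inP/(_ _ Cy) := chC _ Cx.
  have le_yx : (y <= x)%N := max_x _ Cy.
  have lt_xs := lt_C _ Cx; have := down_size_le y bs.
  have : (down_size s x <= head 0 s)%N.
    by rewrite -down_size_last; apply: down_size_mono => //; lia.
  have {}ne_yx : (y != x :> nat) := ne_yx.
  by rewrite !canon_relE /canon_nat; lia.
have le_h : (head 0 s <= size s)%N by have := ballot_head bs; lia.
apply: (IHk _ _ (ballot_drop _ bs) bnc_s) => [y /below_x|].
  by rewrite size_drop; lia.
apply/forall_inP=> y Cy; apply/forall_inP=> z Cz.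
have := below_x y Cy; have := below_x z Cz => lt_z lt_y.
have [/setD1P[_ {}Cy] /setD1P[_ {}Cz]] := (Cy, Cz).
have /forall_inP/(_ _ Cz) := chC _ Cy.
by rewrite !canon_relE /canon_nat !down_size_drop //; lia.
Qed.

Lemma bounces_size k s : ~~ bounces k s -> (0 < size s)%N.
Proof. by rewrite lt0n size_eq0; apply: contraNneq => ->; apply: bounces_nil. Qed.

(** The greedy chain: the last point of [s] lies above the first [head 0 s] points, where the rest
    of the chain is found by induction. *)
Lemma exists_chain k s n : ballot s -> (size s <= n)%N -> ~~ bounces k s ->
  exists C : {set 'I_n}, [/\ {in C, forall x : 'I_n, (x < size s)%N},
    is_chain (canon_rel s) C & #|C| = k.+1].
Proof.
elim: k s => [|k IHk] s bs le_s n_bnc; have s_gt0 := bounces_size n_bnc.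
  have lt_n : ((size s).-1 < n)%N by lia.
  exists [set Ordinal lt_n]; split; last by rewrite cards1.
    by move=> x /set1P -> /=; lia.
  apply/forall_inP=> x /set1P ->; apply/forall_inP=> y /set1P ->.
  by rewrite !canon_relE /canon_nat eqxx.
have lt_n : ((size s).-1 < n)%N by lia.
have le_h := ballot_head bs.
have [|C [lt_C chC card_C]] := IHk _ (ballot_drop _ bs) _ n_bnc.
  by rewrite size_drop; lia.
have {}lt_C x : x \in C -> (x < head 0 s)%N by move/lt_C; rewrite size_drop; lia.
pose z := Ordinal lt_n.
exists (z |: C); split.
- by move=> x /setU1P[->|/lt_C] /=; lia.
- have zC y : y \in C -> canon_rel s y z.
    by move=> /lt_C lt_y; rewrite !canon_relE /canon_nat /= down_size_last lt_y orbT.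
  apply/forall_inP=> x /setU1P[->|Cx]; apply/forall_inP=> y /setU1P[->|Cy].
  + by rewrite !canon_relE /canon_nat eqxx.
  + by rewrite zC ?orbT.
  + by rewrite zC.
  have /forall_inP/(_ _ Cy) := forall_inP chC _ Cx.
  have := lt_C _ Cx; have := lt_C _ Cy; rewrite !canon_relE /canon_nat => ? ?.
  by rewrite !down_size_drop //; lia.
rewrite cardsU1 card_C; suff -> : z \notin C by [].
by apply/negP => /lt_C /=; lia.
Qed.

Lemma max_chainE k s n : ballot s -> size s = n ->
  (\max_(C : {set 'I_n} | is_chain (@canon_rel n s) C) #|C| <= k)%N = bounces k s.
Proof.
move=> bs size_s; apply/idP/idP => [/bigmax_leqP max_k|bnc_s].
  apply: contraT => /(@exists_chain _ _ n bs); rewrite size_s leqnn => -[] // C [_ chC card_C].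
  by have := max_k _ chC; rewrite card_C ltnn.
apply/bigmax_leqP => C chC; apply: card_chain_le bs bnc_s _ chC => x _.
by rewrite size_s.
Qed.

(** The profile is a complete invariant with the ballot lists as values. Keeping [Q] abstract serves
    both length conditions. *)
Lemma card_semiorder_classes n (Q : pred int) :
  #|equivalence_partition (@poset_iso 'I_n)
      [set r | semiorder (graph_rel r) & Q (poset_length (graph_rel r))]| =
  count (fun s => Q (poset_length (@canon_rel n s))) (ballots n).
Proof.
have normal_form (r : {set 'I_n * 'I_n}) : semiorder (graph_rel r) ->
    [/\ poset_iso (canon_graph n (profile (graph_rel r))) r,
        poset_length (graph_rel r) =
          poset_length (@canon_rel n (profile (graph_rel r))) &
        profile (graph_rel r) \in ballots n].
  move=> semi_r; have [f [fP bs]] := canonical_form semi_r.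
  split; last by rewrite mem_ballots bs size_profile card_ord eqxx.
  - by apply/existsP; exists f; apply/forallP=> i; apply/forallP=> j; rewrite fP.
  - exact: poset_length_iso fP.
rewrite -size_filter;
apply: (card_equivalence_partition_seq
  (inv := fun r => profile (graph_rel r))).
- exact/filter_uniq/uniq_ballots.
- move=> r; rewrite inE mem_filter => /andP[/normal_form[_ <- ->] ->] //.
- move=> s; rewrite mem_filter mem_ballots => /andP[Qs /andP[bs /eqP size_s]].
  exists (canon_graph n s); last exact: profile_canon_rel.
  by rewrite inE Qs andbT; apply: semiorder_canon_rel.
move=> r s; rewrite !inE => /andP[/normal_form[iso_r _ _] _].
move=> /andP[/normal_form[iso_s _ _] _].
have equiv := @poset_iso_equiv 'I_n; apply/idP/eqP => [/existsP[f /forallP fP]|eq_rs].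
  by apply/esym/(profile_iso (f := f)) => i j; apply/eqP; apply: (forallP (fP i)).
(* Equal profiles make both relations isomorphic to the same canonical graph. *)
by rewrite -((equiv _ _ s).2 iso_r) eq_rs.
Qed.

Lemma num_semiorders_leE h n :
  num_semiorders_le h n = count (bounces h.+1) (ballots n).
Proof.
rewrite /num_semiorders_le; have -> := @card_semiorder_classes n (fun l => l <= h%:Z).
apply: eq_count_ballots => s bs size_s.
rewrite -(max_chainE _ bs size_s) /poset_length.
by move: (\max_(_ | _) _)%N => m /=; lia.
Qed.

(** Length h means a largest chain of h + 1 points: [bounces h.+1] holds and [bounces h] fails. The
    additive form avoids truncated subtraction. *)
Lemma num_semiorders_eqE h n :
  (num_semiorders_eq h n + count (bounces h) (ballots n))%N =
  count (bounces h.+1) (ballots n).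
Proof.
rewrite /num_semiorders_eq; have -> := @card_semiorder_classes n (fun l => l == h%:Z).
rewrite -count_predUI addnC (eq_count_ballots (Q := pred0)) ?count_pred0 => [|s bs size_s].
  apply: eq_count_ballots => s bs size_s.
  rewrite -[bounces h.+1 s](max_chainE _ bs size_s) [predU _ _ _]/= -(max_chainE _ bs size_s).
  by rewrite /poset_length; move: (\max_(_ | _) _)%N => m /=; lia.
rewrite [predI _ _ _]/= -(max_chainE _ bs size_s) /poset_length.
by move: (\max_(_ | _) _)%N => m /=; lia.
Qed.

Theorem corollary3p1 (h : nat) :
  F_eq h =1 fps_div (fps_of_poly 'X^(h.+1)) (fps_of_poly (p h.+1 * p h)) /\
  F_le h =1 fps_div (fps_of_poly (p h)) (fps_of_poly (p h.+1)).
Proof.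
split=> n; last by rewrite -bounces_le_gf /F_le num_semiorders_leE.
by rewrite -bounces_eq_gf -num_semiorders_eqE natrD addrK.
Qed.
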